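(* Let $\alpha,\beta,\gamma\in\mathbb{R}$, and let $(G_3,g,J)$ be the connected, simply connected three-dimensional Lorentzian Lie group with product structure $J$ whose Lie algebra $\mathfrak{g}$ has a pseudo-orthonormal basis $\{e_1,e_2,e_3\}$ ($e_3$ timelike) with $[e_1,e_2]=-\gamma e_3$, $[e_1,e_3]=-\beta e_2$, $[e_2,e_3]=\alpha e_1$. Let $c\in\mathbb{R}$. Then $(G_3,g,J)$ is a first kind algebraic Ricci soliton associated to the canonical connection $\nabla^0$ with constant $c$ if and only if one of the following holds: (i) $\alpha=\beta=\gamma=0$; in particular, $De_i=-ce_i$ for $i=1,2,3$; (ii) $\alpha=\beta=0$, $\gamma^2=c$; in particular, $De_1=-\frac{\gamma^2}{2}e_1$, $De_2=-\frac{\gamma^2}{2}e_2$, $De_3=-\gamma^2e_3$; (iii) $\alpha\neq0$ or $\beta\neq 0$, and $\gamma=0$, $c=0$; in particular, $D=0$; (iv) $\alpha\neq0$ or $\beta\neq 0$, and $\gamma=\alpha+\beta$, $c=0$; in particular, $D=0$.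
   Context: The left-invariant Lorentzian metric $g$ satisfies $g(e_1,e_1)=g(e_2,e_2)=1$, $g(e_3,e_3)=-1$, $g(e_i,e_j)=0$ for $i\ne j$. All tensors and connections are left-invariant and evaluated on $\mathfrak{g}$. $\nabla$ is the Levi-Civita connection of $g$. The product structure is $Je_1=e_1$, $Je_2=e_2$, $Je_3=-e_3$, and $(\nabla_XJ)Y=\nabla_X(JY)-J(\nabla_XY)$. The canonical connection is $\nabla^0_XY=\nabla_XY-\frac12(\nabla_XJ)(JY)$, with curvature $R^0(X,Y)Z=\nabla^0_X\nabla^0_YZ-\nabla^0_Y\nabla^0_XZ-\nabla^0_{[X,Y]}Z$. Its Ricci tensor is $\rho^0(X,Y)=-g(R^0(X,e_1)Y,e_1)-g(R^0(X,e_2)Y,e_2)+g(R^0(X,e_3)Y,e_3)$ and the Ricci operator $\mathrm{Ric}^0$ is defined by $\rho^0(X,Y)=g(\mathrm{Ric}^0(X),Y)$. First kind algebraic Ricci soliton associated to $\nabla^0$ with constant $c$ means: $\mathrm{Ric}^0=c\,\mathrm{Id}+D$ where $D$ is a derivation of $\mathfrak{g}$, i.e. a linear map with $D[X,Y]=[DX,Y]+[X,DY]$ for all $X,Y\in\mathfrak{g}$. *)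

(* Defs.v *)
From HB Require Import structures.
From mathcomp Require Import all_boot all_order all_algebra.
From mathcomp Require Import reals.

Set Implicit Arguments.
Unset Strict Implicit.
Unset Printing Implicit Defensive.

Import GRing.Theory Num.Theory.
Local Open Scope ring_scope.

(* A simply connected Lie group G with left-invariant tensors is represented
   by its Lie algebra, a finite-dimensional vector space V with bracket br:
   tensors become multilinear maps on V, and a left-invariant connection
   becomes a bilinear map nabla, where nabla X Y stands for the covariant
   derivative of Y along X. *)

Definition lie_bracket (R : realType) (V : vectType R)
    (br : {bilinear V -> V -> V}) : Prop :=
  (forall X, br X X = 0) /\
  (forall X Y Z, br X (br Y Z) + br Y (br Z X) + br Z (br X Y) = 0).

Definition derivation (R : realType) (V : vectType R)
    (br : {bilinear V -> V -> V}) (D : 'End(V)) : Prop :=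
  forall X Y, D (br X Y) = br (D X) Y + br X (D Y).

Definition pseudo_orthonormal_basis (R : realType) (V : vectType R)
    (g : {bilinear V -> V -> R | *%R & *%R}) (e1 e2 e3 : V) : Prop :=
  [/\ basis_of fullv [:: e1; e2; e3],
      [/\ g e1 e1 = 1, g e2 e2 = 1 & g e3 e3 = -1]
    & [/\ g e1 e2 = 0, g e1 e3 = 0 & g e2 e3 = 0]].

Definition product_structure (R : realType) (V : vectType R)
    (J : 'End(V)) (e1 e2 e3 : V) : Prop :=
  [/\ J e1 = e1, J e2 = e2 & J e3 = - e3].

(* For left-invariant Y and Z the function g(Y, Z) is constant, so its
   derivative does not appear in the compatibility of nabla with g. *)
Definition levi_civita (R : realType) (V : vectType R)
    (br : {bilinear V -> V -> V}) (g : {bilinear V -> V -> R | *%R & *%R})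
    (nabla : {bilinear V -> V -> V}) : Prop :=
  (forall X Y, nabla X Y - nabla Y X = br X Y) /\
  (forall X Y Z, g (nabla X Y) Z + g Y (nabla X Z) = 0).

Definition nablaJ (R : realType) (V : vectType R)
    (nabla : V -> V -> V) (J : V -> V) (X Y : V) : V :=
  nabla X (J Y) - J (nabla X Y).

Definition canonical_connection (R : realType) (V : vectType R)
    (nabla : V -> V -> V) (J : V -> V) (X Y : V) : V :=
  nabla X Y - 2^-1 *: nablaJ nabla J X (J Y).

Definition curvature (R : realType) (V : vectType R)
    (br nabla : V -> V -> V) (X Y Z : V) : V :=
  nabla X (nabla Y Z) - nabla Y (nabla X Z) - nabla (br X Y) Z.

(* The signs are those of g on the basis e1, e2, e3. *)
Definition ricci_tensor (R : realType) (V : vectType R)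
    (br : V -> V -> V) (g : V -> V -> R) (e1 e2 e3 : V)
    (nabla : V -> V -> V) (X Y : V) : R :=
  - g (curvature br nabla X e1 Y) e1
  - g (curvature br nabla X e2 Y) e2
  + g (curvature br nabla X e3 Y) e3.

Definition ricci_operator (R : realType) (V : vectType R)
    (g : V -> V -> R) (rho : V -> V -> R) (Ric : 'End(V)) : Prop :=
  forall X Y, rho X Y = g (Ric X) Y.

(* nabla and Ric are uniquely determined by br, g and J, because g is
   nondegenerate. *)
Definition first_kind_soliton_with (R : realType) (V : vectType R)
    (br : {bilinear V -> V -> V}) (g : {bilinear V -> V -> R | *%R & *%R})
    (J : 'End(V)) (e1 e2 e3 : V) (c : R) (D : 'End(V)) : Prop :=
  exists (nabla : {bilinear V -> V -> V}) (Ric : 'End(V)),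
    [/\ levi_civita br g nabla,
        ricci_operator g
          (ricci_tensor br g e1 e2 e3 (canonical_connection nabla J)) Ric,
        Ric = c *: \1%VF + D
      & derivation br D].

Definition first_kind_soliton (R : realType) (V : vectType R)
    (br : {bilinear V -> V -> V}) (g : {bilinear V -> V -> R | *%R & *%R})
    (J : 'End(V)) (e1 e2 e3 : V) (c : R) : Prop :=
  exists D : 'End(V), first_kind_soliton_with br g J e1 e2 e3 c D.

(* Main.v *)
(* In the given frame the canonical connection has the single pair of nonzero
   Christoffel symbols nabla0_{e3} e1 = d e2 and nabla0_{e3} e2 = - d e1, where
   d = (alpha + beta - gamma) / 2, so that
   Ric0 = diag(- gamma d, - gamma d, 0).  Hence D = Ric0 - c Id is diagonal, and
   a diagonal map is a derivation exactly when alpha c = 0, beta c = 0 and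
   gamma (2 gamma d + c) = 0 (one equation per bracket).  The four cases are the
   solutions of this polynomial system. *)

Require Import Defs.
From HB Require Import structures.
From mathcomp Require Import all_boot all_order all_algebra.
From mathcomp Require Import reals.
From mathcomp Require Import ring lra.
Import GRing.Theory Num.Theory.
Local Open Scope ring_scope.

(** * Linear combinations of three vectors, handled through coordinate triples *)

Section Frame.
Context {R : realType} {V : vectType R} (e1 e2 e3 : V).

Definition frame (a b d : R) : V := a *: e1 + b *: e2 + d *: e3.

Lemma frameD a b d a' b' d' :
  frame a b d + frame a' b' d' = frame (a + a') (b + b') (d + d').
Proof. by rewrite /frame !scalerDl [LHS]addrACA (addrACA (a *: _)). Qed.

Lemma frameZ k a b d : k *: frame a b d = frame (k * a) (k * b) (k * d).
Proof. by rewrite /frame !scalerDr !scalerA. Qed.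

Lemma frameN a b d : - frame a b d = frame (- a) (- b) (- d).
Proof. by rewrite -scaleN1r frameZ !mulN1r. Qed.

Lemma frame_e1 : e1 = frame 1 0 0.
Proof. by rewrite /frame scale1r !scale0r !addr0. Qed.

Lemma frame_e2 : e2 = frame 0 1 0.
Proof. by rewrite /frame scale1r !scale0r add0r addr0. Qed.

Lemma frame_e3 : e3 = frame 0 0 1.
Proof. by rewrite /frame scale1r !scale0r !add0r. Qed.

Lemma linear_frame (U : lmodType R) (f : {linear V -> U}) a b d :
  f (frame a b d) = a *: f e1 + b *: f e2 + d *: f e3.
Proof. by rewrite /frame !linearD !linearZ. Qed.

Lemma frame_onto : basis_of fullv [:: e1; e2; e3] ->
  forall X, exists a b d, X = frame a b d.
Proof.
move=> eB X; have eB3 : basis_of fullv [tuple e1; e2; e3] by [].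
have := coord_basis eB3 (memvf X); rewrite !big_ord_recl big_ord0 addr0 addrA.
by move=> /= ->; do 3!eexists.
Qed.

End Frame.

(** * Metric, bracket and product structure in coordinates *)

Section Soliton.
Context {R : realType} {V : vectType R}.
Variables (br : {bilinear V -> V -> V}) (g : {bilinear V -> V -> R | *%R & *%R}).
Variables (J : 'End(V)) (e1 e2 e3 : V) (alpha beta gamma c : R).
Hypotheses (br_lie : lie_bracket br) (g_sym : forall X Y, g X Y = g Y X)
  (e_basis : pseudo_orthonormal_basis g e1 e2 e3)
  (J_prod : product_structure J e1 e2 e3)
  (br12 : br e1 e2 = - gamma *: e3)
  (br13 : br e1 e3 = - beta *: e2)
  (br23 : br e2 e3 = alpha *: e1).

Local Notation vec := (frame e1 e2 e3).

Lemma vecP X : exists a b d, X = vec a b d.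
Proof. by case: e_basis => eB _ _; apply: frame_onto. Qed.

Lemma metric_vec a b d a' b' d' :
  g (vec a b d) (vec a' b' d') = a * a' + b * b' - d * d'.
Proof.
case: e_basis => _ [g11 g22 g33] [g12 g13 g23].
rewrite /frame !(linearDl, linearDr) !(linearZl_LR, linearZr_LR) /=.
rewrite g11 g22 g33 (g_sym e2 e1) (g_sym e3 e1) (g_sym e3 e2) g12 g13 g23.
by ring.
Qed.

Lemma metric_basis a b d :
  [/\ g (vec a b d) e1 = a, g (vec a b d) e2 = b & g (vec a b d) e3 = - d].
Proof.
split; [rewrite [X in g _ X](frame_e1 e1 e2 e3)
       |rewrite [X in g _ X](frame_e2 e1 e2 e3)
       |rewrite [X in g _ X](frame_e3 e1 e2 e3)];
  by rewrite metric_vec; ring.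
Qed.

Lemma bracket_vec a b d a' b' d' :
  br (vec a b d) (vec a' b' d') =
  vec (alpha * (b * d' - d * b')) (- beta * (a * d' - d * a'))
    (- gamma * (a * b' - b * a')).
Proof.
case: br_lie => br_alt _.
(* Polarisation: expand the alternating identity at [X + Y]. *)
have brC X Y : br Y X = - br X Y.
  apply/eqP; rewrite -addr_eq0; apply/eqP; move: (br_alt (X + Y)).
  by rewrite linearDl !linearDr !br_alt add0r addr0 addrC.
have [v12 v13 v23] : [/\ br e1 e2 = vec 0 0 (- gamma),
    br e1 e3 = vec 0 (- beta) 0 & br e2 e3 = vec alpha 0 0].
  by rewrite br12 br13 br23 /frame !scale0r !add0r !addr0.
(* Zero is also put in frame form, so that every term merges into a single triple. *)
have v0 : 0 = vec 0 0 0 by rewrite /frame !scale0r !addr0.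
rewrite [in LHS]/frame !(linearDl, linearDr) !(linearZl_LR, linearZr_LR) /=.
rewrite !br_alt (brC e1 e2) (brC e1 e3) (brC e2 e3) v12 v13 v23 v0.
by rewrite !(frameN, frameZ, frameD); congr frame; ring.
Qed.

Lemma product_vec a b d : J (vec a b d) = vec a b (- d).
Proof.
case: J_prod => J1 J2 J3.
by rewrite linear_frame /= J1 J2 J3 /frame scalerN scaleNr.
Qed.

(** Nondegeneracy of [g]: pairing with the frame vectors recovers each coordinate up to sign. *)
Lemma metric_inj X Y : (forall Z, g X Z = g Y Z) -> X = Y.
Proof.
have [a [b [d ->]]] := vecP X; have [a' [b' [d' ->]]] := vecP Y => gXY.
move: (gXY (vec 1 0 0)) (gXY (vec 0 1 0)) (gXY (vec 0 0 1)).
by rewrite !metric_vec => h1 h2 h3; congr frame; lra.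
Qed.

Lemma vec_inj a b d a' b' d' :
  vec a b d = vec a' b' d' -> [/\ a = a', b = b' & d = d'].
Proof.
move=> eqv; have gE Z := congr1 (g ^~ Z) eqv.
move: (gE (vec 1 0 0)) (gE (vec 0 1 0)) (gE (vec 0 0 1)).
by rewrite /= !metric_vec => h1 h2 h3; split; lra.
Qed.

(** * Levi-Civita connection *)

(** Koszul formula without derivative terms, since [g] is constant on left-invariant fields. It is a
    linear combination of the three cyclic compatibility identities, once torsion-freeness has
    removed the brackets. *)
Lemma koszul (nabla : {bilinear V -> V -> V}) X Y Z : levi_civita br g nabla ->
  2 * g (nabla X Y) Z = g (br X Y) Z - g (br Y Z) X + g (br Z X) Y.
Proof.
case=> torsion_free compat; rewrite -!torsion_free !linearBl.
have := (compat X Y Z, compat Y Z X, compat Z X Y).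
rewrite (g_sym Y (nabla X Z)) (g_sym Z (nabla Y X)) (g_sym X (nabla Z Y)).
case=> [[h1 h2] h3]; lra.
Qed.

(** The Koszul formula solved in the frame; for instance the [a * b'] term says that [nabla e1 e2]
    is [(alpha - beta - gamma) / 2 *: e3]. *)
Definition levi_civita_coef (a b d a' b' d' : R) : V :=
  vec ((alpha - beta + gamma) / 2 * b * d' - (alpha + beta - gamma) / 2 * d * b')
      ((alpha - beta - gamma) / 2 * a * d' + (alpha + beta - gamma) / 2 * d * a')
      ((alpha - beta - gamma) / 2 * a * b' + (alpha - beta + gamma) / 2 * b * a').

Lemma levi_civita_vec (nabla : {bilinear V -> V -> V}) a b d a' b' d' :
  levi_civita br g nabla ->
  nabla (vec a b d) (vec a' b' d') = levi_civita_coef a b d a' b' d'.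
Proof.
move=> lc; apply: metric_inj => Z; have [x [y [z ->]]] := vecP Z.
have := koszul nabla (vec a b d) (vec a' b' d') (vec x y z) lc.
rewrite !bracket_vec !metric_vec => h.
by lra.
Qed.

(** The soliton predicate asks for some [nabla], so its converse direction needs an actual bilinear
    map. *)
Lemma levi_civita_exists : exists nabla : {bilinear V -> V -> V},
  levi_civita br g nabla.
Proof.
(* Coordinates are read off by the metric; the last sign comes from [g e3 e3 = -1]. *)
pose f X Y := levi_civita_coef (g X e1) (g X e2) (- g X e3)
                               (g Y e1) (g Y e2) (- g Y e3).
have fE a b d a' b' d' :
    f (vec a b d) (vec a' b' d') = levi_civita_coef a b d a' b' d'.
  rewrite /f; have [-> -> ->] := metric_basis a b d.
  by have [-> -> ->] := metric_basis a' b' d'; rewrite !opprK.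
have f_bilinear : bilinear_for *:%R *:%R f.
  by split=> U k X Y; have [x1 [x2 [x3 ->]]] := vecP X;
    have [y1 [y2 [y3 ->]]] := vecP Y; have [u1 [u2 [u3 ->]]] := vecP U;
    rewrite /= frameZ frameD !fE /levi_civita_coef frameZ frameD;
    congr frame; ring.
pose fB := bilinear_isBilinear.Build R V V V *:%R *:%R f f_bilinear.
pose nabla : {bilinear V -> V -> V} := HB.pack f fB.
have nablaE X Y : nabla X Y = f X Y by [].
exists nabla; split=> X Y; have [x1 [x2 [x3 ->]]] := vecP X;
  have [y1 [y2 [y3 ->]]] := vecP Y.
- rewrite !nablaE !fE bracket_vec frameN frameD.
  by congr frame; lra.
- move=> Z; have [z1 [z2 [z3 ->]]] := vecP Z.
  by rewrite !nablaE !fE !metric_vec; ring.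
Qed.

(** * Canonical connection, its curvature and its Ricci operator *)

Local Notation delta := ((alpha + beta - gamma) / 2).

(* As J is parallel for the canonical connection, only the Christoffel symbols
   mixing e1 and e2 survive. *)
Lemma canonical_vec (nabla : {bilinear V -> V -> V}) a b d a' b' d' :
  levi_civita br g nabla ->
  canonical_connection nabla J (vec a b d) (vec a' b' d') =
  vec (- delta * d * b') (delta * d * a') 0.
Proof.
move=> lc; rewrite /canonical_connection /nablaJ !product_vec.
rewrite !levi_civita_vec // /levi_civita_coef product_vec.
by rewrite !(frameN, frameD, frameZ); congr frame; lra.
Qed.

(** All covariant derivatives are multiples of one rotation generator of the [e1], [e2] plane, hence
    commute. Only the bracket term survives, through the [e3] coordinate of the bracket. *)
Lemma curvature_vec (nabla : {bilinear V -> V -> V}) a b d a' b' d' x y z :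
  levi_civita br g nabla ->
  curvature br (canonical_connection nabla J)
    (vec a b d) (vec a' b' d') (vec x y z) =
  vec (- gamma * delta * (a * b' - b * a') * y)
      (gamma * delta * (a * b' - b * a') * x) 0.
Proof.
move=> lc; rewrite /curvature bracket_vec !canonical_vec //.
by rewrite !(frameN, frameD); congr frame; lra.
Qed.

Lemma ricci_vec (nabla : {bilinear V -> V -> V}) a b d a' b' d' :
  levi_civita br g nabla ->
  ricci_tensor br g e1 e2 e3 (canonical_connection nabla J)
    (vec a b d) (vec a' b' d') = - gamma * delta * (a * a' + b * b').
Proof.
move=> lc; pose curv Y := curvature br (canonical_connection nabla J)
  (vec a b d) Y (vec a' b' d').
(* Expanding [e1] in place would also hit its occurrences inside [vec]; folding the triples back is
   safe. *)
transitivity (- g (curv (vec 1 0 0)) (vec 1 0 0)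
  - g (curv (vec 0 1 0)) (vec 0 1 0) + g (curv (vec 0 0 1)) (vec 0 0 1)).
  by rewrite -frame_e1 -frame_e2 -frame_e3.
by rewrite /curv !curvature_vec // !metric_vec; lra.
Qed.

Lemma ricci_operatorP (nabla : {bilinear V -> V -> V}) (Ric : 'End(V)) :
  levi_civita br g nabla ->
  ricci_operator g
    (ricci_tensor br g e1 e2 e3 (canonical_connection nabla J)) Ric <->
  forall a b d, Ric (vec a b d) = vec (- gamma * delta * a) (- gamma * delta * b) 0.
Proof.
move=> lc; split=> [RicE a b d | RicE X Y].
  apply: metric_inj => Z; rewrite -RicE; have [x [y [z ->]]] := vecP Z.
  by rewrite ricci_vec // metric_vec; ring.
have [a [b [d ->]]] := vecP X; have [x [y [z ->]]] := vecP Y.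
by rewrite RicE ricci_vec // metric_vec; ring.
Qed.

(** * Diagonal derivations and the soliton equations *)

(** Each bracket of two frame vectors is a multiple of the third, so its weight must be the sum of
    the two others unless the structure constant vanishes. *)
Lemma derivation_diag (D : 'End(V)) p q r :
  (forall a b d, D (vec a b d) = vec (p * a) (q * b) (r * d)) ->
  derivation br D <->
  [/\ alpha * (p - q - r) = 0, beta * (q - p - r) = 0
    & gamma * (r - p - q) = 0].
Proof.
move=> DE; split=> [derD | [h1 h2 h3] X Y]; last first.
  have [a [b [d ->]]] := vecP X; have [x [y [z ->]]] := vecP Y.
  rewrite !(DE, bracket_vec) frameD; congr frame.
  (* The equation is multiplied by its coordinate minor first, which leaves a goal linear in the
     monomials. *)
  - by have := congr1 ( *%R (b * z - d * y)) h1; lra.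
  - by have := congr1 ( *%R (a * z - d * x)) h2; lra.
  - by have := congr1 ( *%R (a * y - b * x)) h3; lra.
move: (derD (vec 1 0 0) (vec 0 1 0)) (derD (vec 1 0 0) (vec 0 0 1))
  (derD (vec 0 1 0) (vec 0 0 1)).
rewrite !(DE, bracket_vec) !frameD.
by move=> /vec_inj[_ _ h1] /vec_inj[_ h2 _] /vec_inj[h3 _ _]; split; lra.
Qed.

Lemma diag_End p q r : exists D : 'End(V),
  forall a b d, D (vec a b d) = vec (p * a) (q * b) (r * d).
Proof.
(* The sign of [r] compensates for the timelike [e3]. *)
pose f X := vec (p * g X e1) (q * g X e2) (- r * g X e3).
have f_linear : linear f.
  move=> k X Y; rewrite /f !(linearDl, linearZl_LR) /= frameZ frameD.
  by congr frame; ring.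
pose F : {linear V -> V} :=
  HB.pack f (GRing.isLinear.Build R V V *:%R f f_linear).
exists (linfun F) => a b d; rewrite lfunE /= /f.
by have [-> -> ->] := metric_basis a b d; rewrite mulrNN.
Qed.

(** [D] is forced to be the Ricci operator minus [c] times the identity; the equations are those of
    [derivation_diag] at [p = q = - (gamma * delta + c)] and [r = - c]. *)
Lemma soliton_withP (D : 'End(V)) :
  first_kind_soliton_with br g J e1 e2 e3 c D <->
  (forall a b d, D (vec a b d) =
     vec (- (gamma * delta + c) * a) (- (gamma * delta + c) * b) (- c * d)) /\
  [/\ alpha * c = 0, beta * c = 0 & gamma * (2 * gamma * delta + c) = 0].
Proof.
have RicD (Ric : 'End(V)) : Ric = c *: \1%VF + D ->
    (forall a b d, Ric (vec a b d) =
       vec (- gamma * delta * a) (- gamma * delta * b) 0) <->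
    (forall a b d, D (vec a b d) =
       vec (- (gamma * delta + c) * a) (- (gamma * delta + c) * b) (- c * d)).
  move=> ->; split=> E a b d.
    have := E a b d; rewrite add_lfunE scale_lfunE id_lfunE => /(canRL (addKr _)) ->.
    by rewrite frameZ frameN frameD; congr frame; ring.
  by rewrite add_lfunE scale_lfunE id_lfunE E frameZ frameD; congr frame; ring.
split=> [[nabla [Ric [lc ricE RicE derD]]] | [DE eqs]].
  move/(ricci_operatorP _ _ lc)/(RicD _ RicE): ricE => DE; split=> //.
  by case/(derivation_diag _ _ _ _ DE): derD => h1 h2 h3; split; lra.
have [nabla lc] := levi_civita_exists.
exists nabla, (c *: \1%VF + D); split=> //.
  by apply/ricci_operatorP => //; apply/(RicD _ erefl).
by apply/(derivation_diag _ _ _ _ DE); case: eqs => h1 h2 h3; split; lra.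
Qed.

Lemma solitonP : first_kind_soliton br g J e1 e2 e3 c <->
  [/\ alpha * c = 0, beta * c = 0 & gamma * (2 * gamma * delta + c) = 0].
Proof.
split=> [[D] /soliton_withP[] // | eqs].
have [D DE] := diag_End (- (gamma * delta + c)) (- (gamma * delta + c)) (- c).
by exists D; apply/soliton_withP; split.
Qed.

(** If [alpha] and [beta] vanish, the last equation becomes [gamma * (c - gamma ^+ 2) = 0].
    Otherwise [c = 0], and it becomes [gamma ^+ 2 * (alpha + beta - gamma) = 0]. *)
Lemma soliton_equationsP :
  [/\ alpha * c = 0, beta * c = 0 & gamma * (2 * gamma * delta + c) = 0] <->
  [\/ [/\ alpha = 0, beta = 0 & gamma = 0],
        [/\ alpha = 0, beta = 0 & gamma ^+ 2 = c],
        [/\ alpha <> 0 \/ beta <> 0, gamma = 0 & c = 0]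
      | [/\ alpha <> 0 \/ beta <> 0, gamma = alpha + beta & c = 0]].
Proof.
split; last by case=> [[-> -> ->]|[-> -> <-]|[_ -> ->]|[_ -> ->]]; split; field.
case=> /eqP h1 /eqP h2 /eqP; rewrite mulf_eq0 => h3.
have [[a0 b0]|ab] : (alpha = 0 /\ beta = 0) \/ (alpha <> 0 \/ beta <> 0).
- by case: (alpha =P 0) => a0; case: (beta =P 0) => b0; auto.
- case/orP: h3 => /eqP h3; first by constructor 1.
  by constructor 2; split=> //; move: h3; rewrite a0 b0; lra.
have c0 : c = 0.
  by case: ab h1 h2 => /eqP/negPf n0; rewrite !mulf_eq0 n0 /= => h1 h2;
    apply/eqP.
have [g0|g1] : gamma = 0 \/ gamma = alpha + beta.
- case: (gamma =P 0) h3 => [|g0 /= /eqP h]; [by left | right].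
  by apply: (mulfI (introN eqP g0)); move: h; rewrite c0; lra.
- by constructor 3.
- by constructor 4.
Qed.

End Soliton.

Theorem theorem2p26 (R : realType) (V : vectType R)
    (br : {bilinear V -> V -> V}) (g : {bilinear V -> V -> R | *%R & *%R})
    (J : 'End(V)) (e1 e2 e3 : V) (alpha beta gamma c : R)
    (br_lie : lie_bracket br)
    (g_sym : forall X Y, g X Y = g Y X)
    (e_basis : pseudo_orthonormal_basis g e1 e2 e3)
    (J_prod : product_structure J e1 e2 e3)
    (br12 : br e1 e2 = - gamma *: e3)
    (br13 : br e1 e3 = - beta *: e2)
    (br23 : br e2 e3 = alpha *: e1) :
  (first_kind_soliton br g J e1 e2 e3 c <->
    [\/ [/\ alpha = 0, beta = 0 & gamma = 0],
        [/\ alpha = 0, beta = 0 & gamma ^+ 2 = c],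
        [/\ alpha <> 0 \/ beta <> 0, gamma = 0 & c = 0]
      | [/\ alpha <> 0 \/ beta <> 0, gamma = alpha + beta & c = 0]]) /\
  (forall D : 'End(V), first_kind_soliton_with br g J e1 e2 e3 c D ->
    [/\ [/\ alpha = 0, beta = 0 & gamma = 0] ->
          [/\ D e1 = - c *: e1, D e2 = - c *: e2 & D e3 = - c *: e3],
        [/\ alpha = 0, beta = 0 & gamma ^+ 2 = c] ->
          [/\ D e1 = - (gamma ^+ 2 / 2) *: e1,
              D e2 = - (gamma ^+ 2 / 2) *: e2
            & D e3 = - gamma ^+ 2 *: e3],
        [/\ alpha <> 0 \/ beta <> 0, gamma = 0 & c = 0] -> D = 0
      & [/\ alpha <> 0 \/ beta <> 0, gamma = alpha + beta & c = 0] ->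
          D = 0]).
Proof.
split=> [|D sol].
  apply: (iff_trans _ (soliton_equationsP _ _ _ _)).
  exact: solitonP br_lie g_sym e_basis J_prod br12 br13 br23.
have [/(_ sol)[DE _] _] :=
  soliton_withP br g J e1 e2 e3 alpha beta gamma c
    br_lie g_sym e_basis J_prod br12 br13 br23 D.
have De1 := DE 1 0 0; have De2 := DE 0 1 0; have De3 := DE 0 0 1.
move: De1 De2 De3; rewrite -frame_e1 -frame_e2 -frame_e3 !mulr1 !mulr0.
rewrite /frame !scale0r !addr0 !add0r => De1 De2 De3.
(* Shared by the last two cases: either [gamma] or [alpha + beta - gamma] vanishes. *)
have D_eq0 : gamma * ((alpha + beta - gamma) / 2) = 0 -> c = 0 -> D = 0.
  move=> k0 c0; apply/lfunP => X; rewrite zero_lfunE.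
  have [a [b [d ->]]] := vecP _ _ _ _ e_basis X.
  by rewrite DE k0 c0 add0r oppr0 !mul0r /frame !scale0r !addr0.
split.
- by case=> a0 b0 g0; rewrite De1 De2 De3 a0 b0 g0 mul0r add0r.
(* Here [gamma * delta] is [- gamma ^+ 2 / 2], and adding [c = gamma ^+ 2] gives
   [gamma ^+ 2 / 2]. *)
- rewrite De1 De2 De3 => -[-> -> <-].
  by split=> //; congr (_ *: _); field.
- by case=> _ g0; apply: D_eq0; rewrite g0 mul0r.
- by case=> _ g_ab; apply: D_eq0; rewrite g_ab subrr mul0r mulr0.
Qed.
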